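(* Let $p,q,k$ be positive integers satisfying $p>2$, $q>kp+2$, and let $e=p(q-k)$. Then no graph $G\in\mathcal{K}(p,q,e)$ attaining $\max_{G\in\mathcal{K}(p,q,e)}\rho(G)$ is of the form ${}^eK_{s,t}$ or $K^e_{s,t}$ for positive integers $s\le t$; that is, the Bhattacharya–Friedland–Peled conjecture (that an extremal graph for $\max_{G\in\mathcal{K}(p,q,e)}\rho(G)$ is obtained from a complete bipartite graph by adding one vertex and a corresponding number of edges) is false for these $p,q,e$.
   Context: $\rho(G)$ denotes the spectral radius (largest adjacency eigenvalue) of a graph $G$. For positive integers $p\le q$ and $e<pq$, $\mathcal{K}(p,q,e)$ is the family of subgraphs of the complete bipartite graph $K_{p,q}$ (parts of orders $p$ and $q$) with exactly $e$ edges, no isolated vertices, and which are not complete bipartite graphs. For positive integers $s\le t$: if $st-t<e<st$, ${}^eK_{s,t}$ is obtained from $K_{s,t}$ by deleting $st-e$ edges all incident with one common vertex in the part of order $s$; if $st-s<e<st$, $K^e_{s,t}$ is obtained from $K_{s,t}$ by deleting $st-e$ edges all incident with one common vertex in the part of order $t$. These are the graphs obtained from a complete bipartite graph by adding one vertex and a corresponding number of edges. *)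

(* Defs.v *)
From HB Require Import structures.
From mathcomp Require Import all_boot all_order all_algebra.
From mathcomp Require Import all_classical all_reals.

Set Implicit Arguments.
Unset Strict Implicit.
Unset Printing Implicit Defensive.

Import Order.TTheory GRing.Theory Num.Theory.

(* The vertex set of a graph is a subset of the ambient type T, so that
   non-spanning subgraphs are graphs over the same ambient type. *)
Record graph (T : finType) := Graph {
  verts : {set T};
  edges : {set {set T}};
  edgesP : forall f, f \in edges -> #|f| = 2 /\ f \subset verts
}.

Definition subgraph (T : finType) (G H : graph T) : Prop :=
  verts G \subset verts H /\ edges G \subset edges H.

Definition no_isolated (T : finType) (G : graph T) : Prop :=
  forall v, v \in verts G -> exists2 f, f \in edges G & v \in f.

Definition isomorphic (T U : finType) (G : graph T) (H : graph U) : Prop :=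
  exists h : T -> U,
    [/\ {in verts G &, injective h},
        h @: verts G = verts H &
        [set h @: (f : {set T}) | f in edges G] = edges H].

Section DeleteEdges.
Variables (T : finType) (G : graph T) (D : {set {set T}}).

Lemma del_edgesP f :
  f \in edges G :\: D -> #|f| = 2 /\ f \subset verts G.
Proof. by case/setDP=> /edgesP. Qed.

Definition del_edges : graph T := Graph del_edgesP.
End DeleteEdges.

Section CompleteBipartite.
Variables s t : nat.

Definition Kst_edges : {set {set ('I_s + 'I_t)%type}} :=
  [set [set inl x.1; inr x.2] | x in [set: 'I_s * 'I_t]].

Lemma Kst_edgesP f :
  f \in Kst_edges -> #|f| = 2 /\ f \subset [set: ('I_s + 'I_t)%type].
Proof. by case/imsetP=> x _ ->; rewrite cards2 finset.subsetT. Qed.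

(* Part of order s: the vertices inl i; part of order t: the vertices inr j. *)
Definition Kst : graph ('I_s + 'I_t)%type := Graph Kst_edgesP.
End CompleteBipartite.

Definition complete_bipartite (T : finType) (G : graph T) : Prop :=
  exists s t : nat, [/\ 0 < s, 0 < t & isomorphic G (Kst s t)].

(* G is (isomorphic to) H minus m edges, all incident with v. *)
Definition star_deletion (T U : finType) (G : graph T)
    (H : graph U) (v : U) (m : nat) : Prop :=
  exists D : {set {set U}},
    [/\ D \subset edges H, #|D| = m, forall f, f \in D -> v \in f &
        isomorphic G (del_edges H D)].

(* ^e K_{s,t} *)
Definition is_eKst (T : finType) (G : graph T) (e s t : nat) : Prop :=
  s * t - t < e < s * t /\
  exists i : 'I_s, star_deletion G (Kst s t) (inl i) (s * t - e).

(* K^e_{s,t} *)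
Definition is_Kest (T : finType) (G : graph T) (e s t : nat) : Prop :=
  s * t - s < e < s * t /\
  exists j : 'I_t, star_deletion G (Kst s t) (inr j) (s * t - e).

Definition family (p q e : nat) (G : graph ('I_p + 'I_q)%type) : Prop :=
  [/\ subgraph G (Kst p q), #|edges G| = e, no_isolated G &
      ~ complete_bipartite G].

Local Open Scope ring_scope.

Definition adjmx (R : realType) (T : finType) (G : graph T)
    : 'M[R]_#|verts G| :=
  \matrix_(i, j) ([set enum_val i; enum_val j] \in edges G)%:R.

(* adjmx is symmetric, so for nonempty G the set of its eigenvalues in R is
   finite and nonempty, and its supremum is the largest eigenvalue. *)
Definition rho (R : realType) (T : finType) (G : graph T) : R :=
  sup [set x : R | eigenvalue (adjmx R G) x]%classic.

Definition extremal (R : realType) (p q e : nat)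
    (G : graph ('I_p + 'I_q)%type) : Prop :=
  family e G /\
  forall H : graph ('I_p + 'I_q)%type, family e H -> rho R H <= rho R G.

(* Main.v *)
(** Write n = q - k, so that e = pn.  Comparing orders and numbers of edges, the
    only graphs of the two excluded shapes in the family are the ^eK_{p,t} with
    t = n + j and 1 <= j <= k, where the exceptional vertex has degree
    d = n - (p-1)j >= 3.  The squares x of their nonzero eigenvalues satisfy
    x^2 - e x + (p-1)pjd = 0.  The competitor is K_{p,n} with one edge removed
    and a pendant edge attached to another vertex of the part of order p; the
    squares of its nonzero eigenvalues are the roots of
    x^3 - e x^2 + (2(n-1)(p-1) + p-2) x - (p-2)(n-1).
    As 2(n-1)(p-1) + p-2 < (p-1)pjd, this cubic is negative at the larger root
    of the quadratic, so it has a still larger root. *)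
Require Import Defs.
From HB Require Import structures.
From mathcomp Require Import all_boot all_order all_algebra.
From mathcomp Require Import all_classical all_reals.
From mathcomp Require Import polyrcf zify ring lra.

Set Implicit Arguments.
Unset Strict Implicit.
Unset Printing Implicit Defensive.

Import Order.TTheory GRing.Theory Num.Theory.
Local Open Scope ring_scope.

(** * Eigenfunctions and bounds on the spectral radius *)

Definition adj (T : finType) (G : graph T) (u v : T) : bool :=
  [set u; v] \in edges G.

Lemma adjC (T : finType) (G : graph T) u v : adj G u v = adj G v u.
Proof. by rewrite /adj finset.setUC. Qed.

Lemma adj_verts (T : finType) (G : graph T) u v :
  adj G u v -> u \in verts G /\ v \in verts G.
Proof.
move=> /edgesP [_ /fintype.subsetP sub].
by split; apply: sub; rewrite !inE eqxx ?orbT.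
Qed.

(** An eigenvector of [adjmx] as a function on the ambient type, free of the indexing by [enum_val];
    since neighbours are vertices, its values off [verts G] never enter. *)
Definition eigenfun (R : realType) (T : finType) (G : graph T) (a : R)
    (f : T -> R) : Prop :=
  (exists2 v, v \in verts G & f v != 0) /\
  forall v, v \in verts G -> a * f v = \sum_(u | adj G u v) f u.

Lemma sum_adj_enum (R : realType) (T : finType) (G : graph T) (f : T -> R) v :
  \sum_(u | adj G u v) f u =
  \sum_(i < #|verts G|) f (enum_val i) * (adj G (enum_val i) v)%:R.
Proof.
rewrite -(big_enum_val (fun u => f u * (adj G u v)%:R)) /=.
rewrite big_mkcond [RHS]big_mkcond; apply: eq_bigr => u _.
case: ifPn => [uv|_]; last by rewrite mulr0 if_same.
by rewrite (adj_verts uv).1 mulr1.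
Qed.

Lemma eigenvalue_adjmxP (R : realType) (T : finType) (G : graph T) (a : R) :
  eigenvalue (adjmx R G) a <-> exists f, eigenfun G a f.
Proof.
split=> [/eigenvalueP [x xA x0]|[f [[v vG fv] fA]]]; last first.
  apply/eigenvalueP; exists (\row_i f (enum_val i)).
    apply/rowP => j; rewrite !mxE fA ?enum_valP // sum_adj_enum.
    by apply: eq_bigr => i _; rewrite !mxE.
  apply/eqP => /rowP /(_ (enum_rank_in vG v)).
  by rewrite !mxE enum_rankK_in // => /eqP; apply/negP.
pose f u := \sum_(i < #|verts G| | enum_val i == u) x 0 i.
have fE i : f (enum_val i) = x 0 i.
  rewrite /f (bigD1 i) //= big1 ?addr0 // => j /andP[/eqP /enum_val_inj ->].
  by rewrite eqxx.
exists f; split.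
  have [i xi] : exists i, x 0 i != 0 by apply/rV0Pn.
  by exists (enum_val i); rewrite ?fE ?enum_valP.
move=> v vG; rewrite -(enum_rankK_in vG vG) fE.
have /rowP /(_ (enum_rank_in vG v)) := xA.
rewrite !mxE => <-; rewrite sum_adj_enum.
by apply: eq_bigr => i _; rewrite fE !mxE.
Qed.

(** For [sup] to dominate its set, the set must be bounded: eigenvalues are roots of the
    characteristic polynomial, hence at most its Cauchy bound. *)
Lemma eigenvalue_le_rho (R : realType) (T : finType) (G : graph T) (a : R) :
  eigenvalue (adjmx R G) a -> a <= rho R G.
Proof.
move=> ha; apply: ub_le_sup => //=.
exists (cauchy_bound (char_poly (adjmx R G))) => x /=.
rewrite eigenvalue_root_char => rx.
have nz : char_poly (adjmx R G) != 0 by rewrite monic_neq0 ?char_poly_monic.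
by have := root_in_cauchy_bound nz rx; rewrite in_itv /= => /andP[_ /ltW].
Qed.

(** The sign of [b] covers an empty spectrum, whose [sup] is 0. *)
Lemma rho_le (R : realType) (T : finType) (G : graph T) (b : R) :
  0 <= b -> (forall a f, eigenfun G a f -> a <= b) -> rho R G <= b.
Proof.
move=> b0 hb; rewrite /rho; set S := [set x | _]%classic.
have [->|/set0P S0] := eqVneq S set0; first by rewrite sup0.
by apply: ge_sup => // x /= /eigenvalue_adjmxP [f /hb].
Qed.

(** * Transport along isomorphisms *)

Lemma isomorphic_inv (T U : finType) (G : graph T) (H : graph U) :
  isomorphic G H -> (0 < #|verts G|)%N ->
  exists g : U -> T,
    [/\ {in verts H &, injective g},
        forall u, u \in verts H -> g u \in verts G,
        forall w, w \in verts G -> exists2 u, u \in verts H & g u = w &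
        {in verts H &, forall u v, adj G (g u) (g v) = adj H u v}].
Proof.
case=> h [inj hV hE] /card_gt0P [w0 w0G].
(* Off [verts H] no preimage need exist, and the default is some vertex [w0]. *)
pose g u := odflt w0 [pick w in verts G | h w == u].
have gP u : u \in verts H -> g u \in verts G /\ h (g u) = u.
  rewrite -hV => /imsetP [w wG ->]; rewrite /g; case: pickP => /=.
    by move=> x /andP[? /eqP].
  by move=> /(_ w); rewrite wG eqxx.
exists g; split.
- by move=> u v /gP [_ hu] /gP [_ hv] guv; rewrite -hu -hv guv.
- by move=> u /gP [].
- move=> w wG; have hw : h w \in verts H by rewrite -hV; apply: imset_f.
  by exists (h w) => //; apply: inj => //; have [] := gP _ hw.
- move=> u v uH vH; have [gu hgu] := gP _ uH; have [gv hgv] := gP _ vH.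
  have im2 x y : h @: [set x; y] = [set h x; h y].
    by rewrite imsetU1 imset_set1.
  rewrite /adj -hE; apply/idP/imsetP => [gE|[f fE uvE]].
    by exists [set g u; g v]; rewrite // im2 hgu hgv.
  have [_ /fintype.subsetP fG] := edgesP fE.
  suff <- : f = [set g u; g v] by [].
  apply/setP => x; apply/idP/idP => [xf|].
    have : h x \in h @: f by apply: imset_f.
    rewrite -uvE !inE => /orP[] /eqP hx; apply/orP; [left|right]; apply/eqP;
    by apply: inj; rewrite ?hgu ?hgv // fG.
  have mem y : y \in verts G -> h y \in h @: f -> y \in f.
    by move=> yG /imsetP [z zf] /inj -> //; apply: fG.
  by rewrite !inE => /orP[] /eqP ->; apply: mem => //;
    rewrite ?hgu ?hgv -uvE !inE eqxx ?orbT.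
Qed.

Lemma eigenfun_iso (R : realType) (T U : finType) (G : graph T) (H : graph U)
    (a : R) f :
  isomorphic G H -> eigenfun G a f -> exists f', eigenfun H a f'.
Proof.
move=> iso [[w wG fw] fA].
have [|g [ginj gG gsurj gadj]] := isomorphic_inv iso.
  by apply/card_gt0P; exists w.
exists (f \o g); split.
  by have [u uH gu] := gsurj _ wG; exists u; rewrite //= gu.
move=> v vH /=; rewrite fA ?gG //.
have gV : g @: verts H = verts G.
  apply/setP => w'; apply/imsetP/idP => [[u uH ->]|/gsurj [u uH <-]].
    exact: gG.
  by exists u.
(* Both sums are cut down to vertices, the only place where [g] is injective, so that one can be
   reindexed along [g]. *)
have dom (S : finType) (K : graph S) (z : S) (F : S -> R) :
    \sum_(u | adj K u z) F u = \sum_(u in verts K | adj K u z) F u.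
  apply: eq_bigl => u; case: (boolP (adj K u z)) => [/adj_verts [-> //]|].
  by rewrite andbF.
rewrite !dom -gV big_imset_cond //; apply: eq_bigl => u.
by case: (boolP (u \in verts H)) => //= uH; rewrite gadj.
Qed.

(** * Complete bipartite graphs and star deletions: sides, orders, deleted edges *)

Definition isl (A B : Type) (u : A + B) : bool :=
  if u is inl _ then true else false.

Lemma adj_Kst s t (u v : 'I_s + 'I_t) : adj (Kst s t) u v = (isl u != isl v).
Proof.
apply/imsetP/idP => [[[i j] _ /= E]|].
  have : u \in [set inl i; inr j] by rewrite -E !inE eqxx.
  rewrite !inE => /orP[] /eqP uE.
     have : inr j \in [set u; v] by rewrite E !inE eqxx orbT.
    by rewrite uE !inE => /orP[/eqP //|/eqP <-].
  have : inl i \in [set u; v] by rewrite E !inE eqxx.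
  by rewrite uE !inE => /orP[/eqP //|/eqP <-].
case: u v => [i|j] [i'|j'] //= _; first by exists (i, j'); rewrite ?inE.
by exists (i', j); rewrite ?inE //= finset.setUC.
Qed.

Lemma adj_del_edges (T : finType) (G : graph T) (D : {set {set T}}) u v :
  adj (del_edges G D) u v = ([set u; v] \notin D) && adj G u v.
Proof. by rewrite /adj inE. Qed.

Lemma card_isl s t (c : bool) :
  #|[set u : 'I_s + 'I_t | isl u == c]| = (if c then s else t).
Proof.
case: c.
  rewrite -[RHS]card_ord -cardsT -(card_imset _ (@inl_inj 'I_s 'I_t)).
  apply: eq_card => u; rewrite !inE; case: u => i /=.
    by rewrite eqxx; apply/esym/imset_f.
  by apply/esym/imsetP => -[].
rewrite -[RHS]card_ord -cardsT -(card_imset _ (@inr_inj 'I_s 'I_t)).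
apply: eq_card => u; rewrite !inE; case: u => i /=.
  by apply/esym/imsetP => -[].
by rewrite eqxx; apply/esym/imset_f.
Qed.

Lemma edge_adj (T : finType) (G : graph T) f x :
  f \in edges G -> x \in f -> exists y, adj G x y.
Proof.
move=> fG xf; have [/eqP /cards2P [a [b [ab fE]]] _] := edgesP fG.
move: xf; rewrite fE !inE => /orP[] /eqP ->.
  by exists b; rewrite /adj -fE.
by exists a; rewrite adjC /adj -fE.
Qed.

Lemma isomorphic_card_verts (T U : finType) (G : graph T) (H : graph U) :
  isomorphic G H -> #|verts G| = #|verts H|.
Proof. by case=> h [hinj <- _]; rewrite card_in_imset. Qed.

Lemma no_isolated_iso (T U : finType) (G : graph T) (H : graph U) u :
  isomorphic G H -> no_isolated G -> u \in verts H -> exists w, adj H u w.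
Proof.
move=> iso noiso uH; have [|g [_ gG gsurj gadj]] := isomorphic_inv iso.
  by rewrite (isomorphic_card_verts iso); apply/card_gt0P; exists u.
have [f fG uf] := noiso (g u) (gG u uH).
have [y uy] := edge_adj fG uf.
have [w wH gw] := gsurj y (adj_verts uy).2.
by exists w; rewrite -gadj // gw.
Qed.

(* A star-deleted complete bipartite graph without isolated vertices is
   connected, hence has only one bipartition. *)
Lemma star_deletion_bipartition s t (D : {set {set 'I_s + 'I_t}})
    (v u0 : 'I_s + 'I_t) (c : 'I_s + 'I_t -> bool) :
  (forall f, f \in D -> v \in f) -> u0 != v -> isl u0 = isl v ->
  (forall u, exists w, adj (del_edges (Kst s t) D) u w) ->
  (forall u w, adj (del_edges (Kst s t) D) u w -> c u != c w) ->
  exists b, forall u, c u = isl u (+) b.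
Proof.
move=> Dv u0v u0l noiso col.
have adjN u w : u != v -> w != v -> isl u != isl w -> c u != c w.
  move=> uv wv uw; apply: col; rewrite adj_del_edges adj_Kst uw andbT.
  by apply/negP => /Dv; rewrite !inE ![v == _]eq_sym (negPf uv) (negPf wv).
have opp w : isl w != isl v -> c w = ~~ c u0.
  move=> wl; have wv : w != v by apply: contraNneq wl => ->.
  have := adjN _ _ u0v wv; rewrite u0l eq_sym => /(_ wl).
  by case: (c u0) (c w) => [] [].
have same u : isl u = isl v -> c u = c u0.
  move=> ul; have [uE|uv] := eqVneq u v.
    have [w uw] := noiso u; have := col _ _ uw.
    have wl : isl w != isl v.
      by move: uw; rewrite adj_del_edges adj_Kst ul eq_sym => /andP[].
    by rewrite (opp _ wl); case: (c u) (c u0) => [] [].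
  have [w vw] := noiso v.
  have wl : isl w != isl v by move: vw; rewrite adj_del_edges adj_Kst eq_sym => /andP[].
  have wv : w != v by apply: contraNneq wl => ->.
  have := adjN _ _ uv wv; rewrite ul eq_sym => /(_ wl).
  by rewrite (opp _ wl); case: (c u) (c u0) => [] [].
exists (c u0 (+) isl v) => u; have [ul|ul] := eqVneq (isl u) (isl v).
  by rewrite same // ul addbC -addbA addbb addbF.
by rewrite opp //; move: ul; case: (isl u) (isl v) (c u0) => [] [] [].
Qed.

(** The bipartition of [Kst p q] pulls back to a proper 2-colouring of the star deletion, which must
    be its own bipartition up to a swap [b]; each side is then embedded in one side of [Kst p q]. *)
Lemma star_deletion_order p q s t (G : graph ('I_p + 'I_q)%type)
    (v u0 : 'I_s + 'I_t) m :
  subgraph G (Kst p q) -> no_isolated G ->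
  star_deletion G (Kst s t) v m -> u0 != v -> isl u0 = isl v ->
  ((s <= p) && (t <= q) || (s <= q) && (t <= p))%N.
Proof.
move=> [_ sub] noiso [D [_ _ Dv iso]] u0v u0l.
have cV : (0 < #|verts G|)%N.
  by rewrite (isomorphic_card_verts iso); apply/card_gt0P; exists v; rewrite inE.
have [g [ginj gG gsurj gadj]] := isomorphic_inv iso cV.
have gA u w : adj (del_edges (Kst s t) D) u w = adj G (g u) (g w).
  by rewrite gadj ?inE.
have ni u : exists w, adj (del_edges (Kst s t) D) u w.
  by apply: (no_isolated_iso iso noiso); rewrite inE.
have col u w : adj (del_edges (Kst s t) D) u w -> isl (g u) != isl (g w).
  by rewrite gA -adj_Kst; apply: (fintype.subsetP sub).
have [b gb] := star_deletion_bipartition (c := fun u => isl (g u)) Dv u0v u0l ni col.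
have le c : ((if c then s else t) <= if c (+) b then p else q)%N.
  rewrite -(card_isl s t c) -(card_isl p q (c (+) b)).
  have gi : injective g by move=> x y; apply: ginj; rewrite inE.
  rewrite -(card_imset _ gi); apply/subset_leq_card/fintype.subsetP => y.
  by case/imsetP => u; rewrite !inE => /eqP <- ->; rewrite gb.
by move: (le true) (le false); case: (b) => /= -> ->; rewrite ?orbT.
Qed.

(** A deleted edge contains [inl i0], so it is determined by its other end; [J] collects these
    ends. *)
Lemma star_deletion_adj s t (D : {set {set 'I_s + 'I_t}}) (i0 : 'I_s) :
  D \subset edges (Kst s t) -> (forall f, f \in D -> inl i0 \in f) ->
  exists2 J : {set 'I_t}, #|J| = #|D| &
    forall i j, adj (del_edges (Kst s t) D) (inl i) (inr j) =
                (i != i0) || (j \notin J).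
Proof.
move=> /fintype.subsetP DK Dv.
pose F (j : 'I_t) : {set 'I_s + 'I_t} := [set inl i0; inr j].
exists [set j | F j \in D].
  have Finj : injective F.
    move=> j j' /setP /(_ (inr j)); rewrite !inE eqxx /= => /esym /eqP.
    by case.
  rewrite -(card_imset _ Finj); apply: eq_card => f.
  apply/imsetP/idP => [[j]|fD]; first by rewrite inE => jD ->.
  have /imsetP [[i j] _ /= fE] := DK _ fD.
  have := Dv _ fD; rewrite fE !inE orbF => /eqP [i0E].
  by exists j; rewrite ?inE /F i0E -?fE.
move=> i j; rewrite adj_del_edges adj_Kst andbT !inE.
have [-> //|ii0] := eqVneq i i0.
by apply/negP => /Dv; rewrite !inE orbF => /eqP [E]; rewrite E eqxx in ii0.
Qed.

(** * The spectrum of a star deletion *)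

Lemma sum_adj_bipartite (R : realType) s t (K : graph ('I_s + 'I_t)%type)
    (f : 'I_s + 'I_t -> R) :
  (forall u v, adj K u v -> isl u != isl v) ->
  (forall i, \sum_(u | adj K u (inl i)) f u =
             \sum_(j | adj K (inl i) (inr j)) f (inr j)) /\
  (forall j, \sum_(u | adj K u (inr j)) f u =
             \sum_(i | adj K (inl i) (inr j)) f (inl i)).
Proof.
move=> bip; split=> [i|j]; rewrite big_sumType /=.
  rewrite [X in X + _]big_pred0 ?add0r; last first.
    by move=> i'; apply/negP => /bip.
  by apply: eq_bigl => j; rewrite adjC.
by rewrite [X in _ + X]big_pred0 ?addr0 // => j'; apply/negP => /bip.
Qed.

(** The row [i0], the other rows, the columns in [J] and those outside form an equitable partition,
    so the eigenvalue equations close up on the class sums [b], [X], [Y2], [Y1]. Eliminating the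
    column sums leaves a 2 by 2 system in [X] and [b], whose determinant is the asserted polynomial
    in [a]. *)
Lemma eigenfun_star_deletion (R : realType) s t (K : graph ('I_s + 'I_t)%type)
    (i0 : 'I_s) (J : {set 'I_t}) (a : R) f :
  verts K = [set: 'I_s + 'I_t] ->
  (forall u v, adj K u v -> isl u != isl v) ->
  (forall i j, adj K (inl i) (inr j) = (i != i0) || (j \notin J)) ->
  eigenfun K a f -> a != 0 ->
  a ^+ 4 - (s * t - #|J|)%:R * a ^+ 2
    + (s.-1 * #|J| * (t - #|J|))%:R = 0.
Proof.
move=> KV bip KA [[v0 _ fv0] fA] a0.
have [sumL sumR] := sum_adj_bipartite f bip.
pose X := \sum_(i | i != i0) f (inl i); pose b := f (inl i0).
pose Y1 := \sum_(j in ~: J) f (inr j); pose Y2 := \sum_(j in J) f (inr j).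
have eL i : i != i0 -> a * f (inl i) = Y1 + Y2.
  move=> ii0; rewrite fA ?KV ?inE // sumL.
  under eq_bigl do rewrite KA ii0.
  rewrite addrC [LHS](bigID (mem J)) /=; congr (_ + _).
  by apply: eq_bigl => j; rewrite !inE.
have eb : a * b = Y1.
  rewrite fA ?KV ?inE // sumL; apply: eq_bigl => j.
  by rewrite KA eqxx !inE.
have e1 j : j \notin J -> a * f (inr j) = X + b.
  move=> jJ; rewrite fA ?KV ?inE // sumR.
  under eq_bigl do rewrite KA jJ orbT.
  by rewrite (bigD1 i0) //= addrC.
have e2 j : j \in J -> a * f (inr j) = X.
  move=> jJ; rewrite fA ?KV ?inE // sumR.
  by apply: eq_bigl => i; rewrite KA jJ orbF.
have EX : a * X = (s.-1)%:R * (Y1 + Y2).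
  rewrite mulr_sumr (eq_bigr (fun=> Y1 + Y2)) // sumr_const mulr_natl.
  by congr (_ *+ _); rewrite -[s in RHS]card_ord -(cardC1 i0).
have mt : (#|J| <= t)%N by rewrite -[X in (_ <= X)%N]card_ord max_card.
have E1 : a * Y1 = (t - #|J|)%:R * (X + b).
  rewrite mulr_sumr (eq_bigr (fun=> X + b)) => [|j]; last by rewrite inE; exact: e1.
  by rewrite sumr_const mulr_natl cardsCs finset.setCK card_ord.
have E2 : a * Y2 = #|J|%:R * X.
  by rewrite mulr_sumr (eq_bigr (fun=> X)) // sumr_const mulr_natl.
have s0 : (0 < s)%N by apply: leq_trans (ltn_ord i0).
have -> : (s * t - #|J| = s.-1 * t + (t - #|J|))%N.
  by rewrite -[s in LHS]prednK // mulSn addnC addnBA.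
rewrite !natrD !natrM !natrB // in E1 *.
move: EX E1 E2 eb; set S := (s.-1)%:R; set T := t%:R; set M := #|J|%:R.
move=> EX E1 E2 eb.
set Q := (X in X = 0).
have L1 : a ^+ 2 * X - S * (T * X + (T - M) * b) = 0.
  rewrite expr2 -mulrA EX mulrCA mulrDr E1 E2; ring.
have L2 : a ^+ 2 * b - (T - M) * (X + b) = 0.
  by rewrite expr2 -mulrA eb E1 subrr.
(* Cramer's rule: the multipliers of [L1] and [L2] are entries of the adjugate of the system, here
   and for [Qb]. *)
have QX : Q * X = 0.
  have -> : Q * X = (a ^+ 2 - (T - M)) * (a ^+ 2 * X - S * (T * X + (T - M) * b))
      + S * (T - M) * (a ^+ 2 * b - (T - M) * (X + b)) by rewrite /Q; ring.
  by rewrite L1 L2 !mulr0 addr0.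
have Qb : Q * b = 0.
  have -> : Q * b = (T - M) * (a ^+ 2 * X - S * (T * X + (T - M) * b))
      + (a ^+ 2 - S * T) * (a ^+ 2 * b - (T - M) * (X + b)) by rewrite /Q; ring.
  by rewrite L1 L2 !mulr0 addr0.
(* A nonzero determinant would give X = b = 0, and then, as [a] is nonzero, every value of [f] would
   vanish. *)
apply/eqP; apply/negPn/negP => Q0.
have X0 : X = 0 by apply/eqP; move/eqP: QX; rewrite mulf_eq0 (negPf Q0).
have b0 : b = 0 by apply/eqP; move/eqP: Qb; rewrite mulf_eq0 (negPf Q0).
have z x : a * x = 0 -> x = 0.
  by move=> /eqP; rewrite mulf_eq0 (negPf a0) => /eqP.
have Y10 : Y1 = 0 by rewrite -eb b0 mulr0.
have Y20 : Y2 = 0 by apply: z; rewrite E2 X0 mulr0.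
case/negP: fv0; apply/eqP; case: v0 => [i|j]; apply: z.
  have [->|/eL ->] := eqVneq i i0; first by rewrite -/b b0 mulr0.
  by rewrite Y10 Y20 addr0.
by have [/e2 ->|/e1 ->] := boolP (j \in J); rewrite X0 ?b0 ?addr0.
Qed.

(** * Bipartite graphs from a relation, and the competitor *)

Section BipGraph.
Variables (p q : nat) (E : rel nat).

Definition bip_edges : {set {set ('I_p + 'I_q)%type}} :=
  [set [set inl x.1; inr x.2] | x in [set x : 'I_p * 'I_q | E x.1 x.2]].

Lemma bip_edgesP f : f \in bip_edges -> #|f| = 2 /\ f \subset finset.cover bip_edges.
Proof.
move=> fE; split; last exact: finset.bigcup_sup.
by case/imsetP: fE => x _ ->; rewrite cards2.
Qed.

(** Taking the union of the edges as vertex set excludes isolated vertices by construction. *)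
Definition bip_graph : graph ('I_p + 'I_q)%type := Graph bip_edgesP.

Lemma pair_set_inj :
  injective (fun x : 'I_p * 'I_q => [set inl x.1; inr x.2] : {set 'I_p + 'I_q}).
Proof.
move=> [i j] [i' j'] /= /setP eq2.
have := eq2 (inl i); rewrite !inE eqxx /= orbF => /esym /eqP [->].
by have := eq2 (inr j); rewrite !inE eqxx orbT /= => /esym /eqP [->].
Qed.

Lemma bip_graph_sub : subgraph bip_graph (Kst p q).
Proof.
split; first exact: finset.subsetT.
by apply: imsetS; apply: finset.subsetT.
Qed.

Lemma bip_graph_no_isolated : no_isolated bip_graph.
Proof. by move=> v /finset.bigcupP [f fE vf]; exists f. Qed.

Lemma card_bip_edges :
  #|edges bip_graph| = (\sum_(i < p) #|[set j : 'I_q | E i j]|)%N.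
Proof.
rewrite /= /bip_edges card_imset; last exact: pair_set_inj.
rewrite -sum1dep_card.
rewrite -(pair_big_dep xpredT (fun (i : 'I_p) (j : 'I_q) => E i j)
  (fun _ _ => 1%N)) /=.
by apply: eq_bigr => i _; rewrite sum1dep_card.
Qed.

Lemma bip_graph_side u v : adj bip_graph u v -> isl u != isl v.
Proof. by rewrite -adj_Kst; apply: (fintype.subsetP bip_graph_sub.2). Qed.

Lemma adj_bip_graph i j : adj bip_graph (inl i) (inr j) = E i j.
Proof.
rewrite /adj /= /bip_edges.
rewrite (mem_imset _ (i, j) pair_set_inj).
by rewrite inE.
Qed.

End BipGraph.

(* [K_{p,n}] minus an edge plus a pendant edge at a new vertex of the second
   part: the vertices of the first part have degrees n+1, n, ..., n, n-1. *)
Definition row_size (p n i : nat) : nat :=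
  if i == 0%N then n.+1 else if i == p.-1 then n.-1 else n.

Definition pendant_graph p q n : graph ('I_p + 'I_q)%type :=
  bip_graph p q (fun i j => j < row_size p n i)%N.

(** The ends of a walk of length three lie on opposite sides. A walk whose closing edge is missing
    therefore shows that a graph is not complete bipartite. *)
Lemma complete_bipartite_trans (T : finType) (G : graph T) a b c d :
  complete_bipartite G -> adj G a b -> adj G b c -> adj G c d -> adj G a d.
Proof.
case=> s [t [_ _ iso]] ab bc cd.
have [aG bG] := adj_verts ab; have [cG dG] := adj_verts cd.
have [|g [_ _ gsurj gadj]] := isomorphic_inv iso.
  by apply/card_gt0P; exists a.
have K u v : adj G (g u) (g v) = (isl u != isl v).
  by rewrite gadj ?inE // adj_Kst.
have [a' _ aE] := gsurj _ aG; have [b' _ bE] := gsurj _ bG.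
have [c' _ cE] := gsurj _ cG; have [d' _ dE] := gsurj _ dG.
move: ab bc cd; rewrite -aE -bE -cE -dE !K.
by case: (isl a') (isl b') (isl c') (isl d') => [] [] [] [].
Qed.

Lemma pendant_graph_family p q n :
  (2 < p)%N -> (1 < n)%N -> (n < q)%N -> Defs.family (p * n)%N (pendant_graph p q n).
Proof.
move=> p2 n1 nq; split.
- exact: bip_graph_sub.
- rewrite card_bip_edges.
  have rq i : (row_size p n i <= q)%N.
    by rewrite /row_size; do ?case: ifP => _; lia.
  have -> : (\sum_(i < p) #|[set j : 'I_q | j < row_size p n i]|
      = \sum_(i < p) row_size p n i)%N.
    apply: eq_bigr => i _; rewrite -sum1dep_card.
    by rewrite -(big_ord_widen q (fun=> 1%N) (rq i)) sum1_card card_ord.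
  case: p p2 {rq} => [|[|p]] // p2.
  rewrite big_ord_recl big_ord_recr /= /row_size /= eqxx.
  rewrite (eq_bigr (fun=> n)) => [|i _]; last first.
    by rewrite /bump /= eqSS ltn_eqF // ltnS.
  by rewrite sum_nat_const card_ord; lia.
- exact: bip_graph_no_isolated.
move=> cb.
have P i j := @adj_bip_graph p q (fun i j => j < row_size p n i)%N i j.
(* The walk r1, c0, r0, w is present, but [r1] is a row of size n, which misses column n, that is
   [w]. *)
pose r0 : 'I_p := Ordinal (ltnW (ltnW p2)); pose r1 : 'I_p := Ordinal (ltnW p2).
pose c0 : 'I_q := Ordinal (leq_ltn_trans (leq0n n) nq); pose w := Ordinal nq.
have r1E : row_size p n r1 = n by rewrite /row_size /=; case: eqP => //; lia.
suff : adj (pendant_graph p q n) (inl r1) (inr w) by rewrite P r1E ltnn.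
apply: (@complete_bipartite_trans _ _ _ (inr c0) (inl r0) _ cb).
- by rewrite P r1E /=; lia.
- by rewrite adjC P.
- by rewrite P /= /row_size /=.
Qed.

(** * The spectrum of the competitor *)

Definition pendant_cubic (R : realType) (p n x : R) : R :=
  x ^+ 3 - p * n * x ^+ 2 + (2 * (n - 1) * (p - 1) + (p - 2)) * x
    - (p - 2) * (n - 1).

Lemma pendant_graph_eigenvalue (R : realType) p q n (m : R) :
  (2 < p)%N -> (1 < n)%N -> (n < q)%N -> 1 < m ->
  pendant_cubic p%:R n%:R (m ^+ 2) = 0 ->
  eigenvalue (adjmx R (pendant_graph p q n)) m.
Proof.
move=> p2 n1 nq m1 cub; apply/eigenvalue_adjmxP.
set l := m ^+ 2 in cub; have l1 : 1 < l by rewrite exprn_egt1.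
have l0 : l != 0 by apply: lt0r_neq0; lra.
have l10 : l - 1 != 0 by apply: lt0r_neq0; lra.
have m0 : m != 0 by apply: lt0r_neq0; lra.
set N : R := n%:R in cub; set P : R := p%:R in cub.
(* The eigenvector is scaled to [m] on the n - 1 columns joined to every row. The row equations and
   that of the pendant column then force [x2], [x1], [x0] and [yw]; [yu] is the value at column n -
   1. *)
pose x2 := N - 1; pose x1 := N - (N - 1) / l.
pose x0 := (N * l - (N - 1)) / (l - 1).
pose yu := m - (N - 1) / m; pose yw := x0 / m.
pose x (i : nat) := if i == 0%N then x0 else if i == p.-1 then x2 else x1.
pose y (j : nat) := if (j < n.-1)%N then m else if j == n.-1 then yu else yw.
pose F (u : 'I_p + 'I_q) := match u with inl i => x i | inr j => y j end.
exists F; have [sumL sumR] := sum_adj_bipartite F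
  (@bip_graph_side p q (fun i j => j < row_size p n i)%N).
have P' i j := @adj_bip_graph p q (fun i j => j < row_size p n i)%N i j.
split.
  pose r0 : 'I_p := Ordinal (ltnW (ltnW p2)).
  pose c0 : 'I_q := Ordinal (leq_ltn_trans (leq0n n) nq).
  exists (inr c0); last by rewrite /F /y /= ifT //; lia.
  have : adj (pendant_graph p q n) (inl r0) (inr c0) by rewrite P' /row_size.
  by case/adj_verts.
have Ysum k : (k <= n.-1)%N -> \sum_(j < k) y j = m *+ k.
  move=> kn; rewrite (eq_bigr (fun=> m)) ?sumr_const ?card_ord // => j _.
  by rewrite /y (leq_trans (ltn_ord j) kn).
have nS : n = n.-1.+1 by rewrite prednK // ltnW.
have NE : N - 1 = (n.-1)%:R by rewrite /N [in LHS]nS -natr1 addrK.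
have y1 : \sum_(j < n.-1) y j = m * (N - 1) by rewrite Ysum // NE mulr_natr.
have y2 : \sum_(j < n) y j = m * (N - 1) + yu.
  by rewrite [in LHS]nS big_ord_recr /= y1 /y ltnn eqxx.
have y3 : \sum_(j < n.+1) y j = m * (N - 1) + yu + yw.
  rewrite big_ord_recr /= y2 /y; congr (_ + _).
  by do ?case: ifP => //; lia.
have pS : p = p.-2.+2 by case: (p) p2 => [|[|?]].
have PE : P - 2 = (p.-2)%:R by rewrite /P [in LHS]pS -!natr1; ring.
have x2E : x p.-1 = x2 by rewrite /x eqxx; case: eqP => //; lia.
have x1E i : (0 < i < p.-1)%N -> x i = x1.
  by move=> /andP[]; rewrite /x; do ?case: eqP => //; lia.
have Xsum (g : nat -> R) c : (forall i, (0 < i < p.-1)%N -> g i = c) ->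
    \sum_(i < p) g i = g 0%N + (P - 2) * c + g p.-1.
  move=> gc; rewrite PE -addrA [in LHS]pS big_ord_recl big_ord_recr /=.
  rewrite (eq_bigr (fun=> c)) => [|i _]; last first.
    by apply: gc; rewrite /bump /=; have := ltn_ord i; lia.
  by rewrite sumr_const card_ord mulr_natl; congr (_ + (_ + g _)); rewrite /bump /=; lia.
(* The equation at a full column, which is the cubic divided by l(l - 1). *)
have main : l = x0 + (P - 2) * x1 + x2.
  apply/eqP; rewrite -subr_eq0; apply/eqP.
  rewrite -[RHS](mul0r (l * (l - 1))^-1) -cub /pendant_cubic /x0 /x1 /x2.
  by field; rewrite ?l0 ?l10.
have mm : m * m = l by [].
case=> [i|j] vG.
  rewrite sumL; under eq_bigl do rewrite P'.
  rewrite -(big_ord_widen q y); last first.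
    by rewrite /row_size; do ?case: ifP => _; lia.
  rewrite /F /row_size /x; case: ifP => _; [rewrite y3|case: ifP => _].
  - rewrite /yu /yw /x0 /l; field.
    by rewrite -/l ?l10 ?m0.
  - by rewrite y1.
  - by rewrite y2 /yu /x1 /l; field.
(* A column beyond n meets no edge, so it is not a vertex and imposes no equation. *)
have jn : (j <= n)%N.
  have [f fE jf] := bip_graph_no_isolated vG.
  have [[i|j'] ij] := edge_adj fE jf; last by have := bip_graph_side ij.
  by move: ij; rewrite adjC P' /row_size; do ?case: ifP => _; lia.
rewrite sumR; under eq_bigl do rewrite P'.
rewrite big_mkcond /=.
pose c := if (j < n)%N then x1 else 0.
rewrite (Xsum (fun i => if (j < row_size p n i)%N then x i else 0) c) => [|i ip].
  rewrite /c x2E /row_size !eqxx [p.-1 == 0%N]gtn_eqF; last lia.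
  rewrite ltnS jn /x /y /=.
  have [jlt|jge] := ltnP j n.-1.
    by rewrite (leq_trans jlt (leq_pred n)) -main.
  have [jE|jne] := eqVneq (j : nat) n.-1.
    rewrite jE -[(_ < n)%N]/(_ <= n)%N -nS leqnn addr0 /yu.
    rewrite mulrBr mm mulrCA mulfV // mulr1 main /x2; ring.
  have -> : (j < n)%N = false by lia.
  by rewrite mulr0 !addr0 /yw mulrCA mulfV // mulr1.
have -> : row_size p n i = n by rewrite /row_size; do ?case: ifP => //; lia.
by rewrite x1E.
Qed.

(** The cubic and x times the quadratic agree in degrees 3 and 2, so at the larger root l of the
    quadratic the cubic is (c1 - E)l - c0 < 0. It is nonnegative at e = pn, and the intermediate
    value theorem yields a root above l. *)
Lemma pendant_graph_rho (R : realType) p q n (E : R) :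
  (2 < p)%N -> (1 < n)%N -> (n < q)%N ->
  2 * (n%:R - 1) * (p%:R - 1) + (p%:R - 2) < E ->
  4 * E <= (p%:R * n%:R) ^+ 2 ->
  exists2 l : R, forall x, x ^+ 2 - p%:R * n%:R * x + E = 0 -> x <= l &
    Num.sqrt l < rho R (pendant_graph p q n).
Proof.
move=> p2 n1 nq; set P : R := p%:R; set N : R := n%:R => EH disc.
have P3 : 3 <= P by rewrite ler_nat.
have N2 : 2 <= N by rewrite ler_nat.
set e := P * N in disc *; have e6 : 6 <= e by rewrite /e; nra.
pose s := Num.sqrt (e ^+ 2 - 4 * E).
have s2 : s ^+ 2 = e ^+ 2 - 4 * E by rewrite sqr_sqrtr // subr_ge0.
have s0 : 0 <= s by rewrite sqrtr_ge0.
pose l := (e + s) / 2; exists l => [x xE|].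
  have : (2 * x - e) ^+ 2 = s ^+ 2.
    rewrite s2 (_ : E = - (x ^+ 2 - e * x)); first ring.
    by apply/eqP; rewrite -addr_eq0 addrC xE.
  move=> /eqP; rewrite eqf_sqr => /orP[] /eqP h; rewrite /l; lra.
have E0 : 0 < E by nra.
have se : s <= e by nra.
have lE : l ^+ 2 - e * l + E = 0.
  have -> : E = (e ^+ 2 - s ^+ 2) / 4 by rewrite s2; field.
  by rewrite /l; field.
(* This makes the square root of any larger root exceed 1, as the eigenvector construction
   requires. *)
have l3 : 3 <= l by rewrite /l; lra.
have le_ : l <= e by rewrite /l; lra.
pose c1 := 2 * (N - 1) * (P - 1) + (P - 2); pose c0 := (P - 2) * (N - 1).
pose C : {poly R} := 'X^3 - e%:P * 'X^2 + c1%:P * 'X - c0%:P.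
have CE x : C.[x] = pendant_cubic P N x.
  by rewrite /pendant_cubic -/e -/c1 -/c0 /C !hornerE.
have Cl : C.[l] < 0.
  have -> : C.[l] = l * (l ^+ 2 - e * l + E) + (c1 - E) * l - c0.
    by rewrite CE /pendant_cubic -/e -/c1 -/c0; ring.
  rewrite lE mulr0 add0r.
  have : 0 <= c0 by rewrite /c0; nra.
  have : (c1 - E) * l < 0 by rewrite pmulr_llt0 ?subr_lt0 //; lra.
  lra.
have Ce : 0 <= C.[e].
  have -> : C.[e] = c1 * e - c0.
    by rewrite CE /pendant_cubic -/e -/c1 -/c0; ring.
  have : c0 <= c1 by rewrite /c0 /c1; nra.
  have : 0 <= c0 by rewrite /c0; nra.
  nra.
have sgn : C.[l] <= 0 <= C.[e] by rewrite (ltW Cl) Ce.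
have [x] := poly_ivt le_ sgn.
move=> /andP[lx _] /rootP Cx.
have lx' : l < x.
  rewrite lt_neqAle lx andbT; apply: contra_eqT Cx => /negPn/eqP <-.
  by rewrite lt_eqF.
have x0 : 0 <= x by lra.
apply: (@lt_le_trans _ _ (Num.sqrt x)); first by rewrite ltr_sqrt //; lra.
apply/eigenvalue_le_rho/pendant_graph_eigenvalue => //.
  by rewrite -[X in X < _]sqrtr1 ltr_sqrt; lra.
by rewrite sqr_sqrtr // -CE.
Qed.

(** * Existence of an extremal graph *)

Lemma graph_eq (T : finType) (G H : graph T) :
  verts G = verts H -> edges G = edges H -> G = H.
Proof.
case: G H => [V E GP] [V' E' HP] /= eV eE; subst V' E'.
by rewrite (Prop_irrelevance GP HP).
Qed.

(** A graph is determined by its vertex and edge sets, a point of a finite type, over which a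
    maximum exists. *)
Lemma extremal_exists (R : realType) p q e (G0 : graph ('I_p + 'I_q)%type) :
  Defs.family e G0 -> exists G : graph ('I_p + 'I_q)%type, extremal R e G.
Proof.
move=> G0e.
pose enc (G : graph ('I_p + 'I_q)%type) := (verts G, edges G).
have enc_inj : injective enc by move=> G H [/graph_eq h /h].
pose A x := `[< exists2 G, Defs.family e G & enc G = x >].
(* [rho] carried over to codes, with the dummy value 0 at pairs that encode no graph. *)
pose f x := if pselect (exists G, enc G = x) is left h
            then rho R (projT1 (cid h)) else 0.
have fE G : f (enc G) = rho R G.
  rewrite /f; case: pselect => [h|]; last by case; exists G.
  by case: (cid h) => G' /= /enc_inj ->.
have A0 : A (enc G0) by apply/asboolP; exists G0.
case: (arg_maxP f A0) => x /asboolP [G Ge <-] Gmax.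
exists G; split=> // H He; rewrite -!fE; apply: Gmax.
by apply/asboolP; exists H.
Qed.

(** * Comparison of the two spectral radii and conclusion *)

(** The second bound, a nonnegative discriminant, follows from 4(p-1)jd <= n^2 by the inequality of
    arithmetic and geometric means. The first fails at j = 1, d = 2, hence the demand that d be at
    least 3. *)
Lemma second_coefficient_bounds p n j d :
  (2 < p)%N -> (0 < j)%N -> (2 < d)%N -> n = (p.-1 * j + d)%N ->
  (2 * n.-1 * p.-1 + p.-2 < p.-1 * (p * j) * d /\
   4 * (p.-1 * (p * j) * d) <= (p * n) ^ 2)%N.
Proof.
case: p => [|[|[|a]]] // _; case: j => // j _; case: d => [|[|[|d]]] // _ ->.
split; rewrite /=; nia.
Qed.

Lemma rho_star_deletion_lt (R : realType) p q n t (G : graph ('I_p + 'I_q)%type)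
    (i0 : 'I_p) :
  (2 < p)%N -> (n < t <= q)%N -> (p.-1 * (t - n) + 2 < n)%N ->
  star_deletion G (Kst p t) (inl i0) (p * t - p * n) ->
  rho R G < rho R (pendant_graph p q n).
Proof.
move=> p2 /andP[nt tq] nbig [D [DK cD Dv iso]].
have [J cJ KA] := star_deletion_adj DK Dv.
(* Of its t edges the exceptional vertex loses pj, which leaves d = n - (p-1)j. *)
pose j := (t - n)%N; pose d := (n - p.-1 * j)%N.
have mE : #|J| = (p * j)%N by rewrite cJ cD -mulnBr.
have pj : (p * j = p.-1 * j + j)%N by rewrite -[in LHS](ltn_predK p2) mulSn addnC.
have tE : (t = n + j)%N by rewrite subnKC // ltnW.
have dE : (t - #|J| = d)%N by rewrite mE pj tE /d; lia.
have nE : n = (p.-1 * j + d)%N by rewrite subnKC //; apply: ltnW; lia.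
have [bE bD] : _ /\ _ := @second_coefficient_bounds p n j d p2
  ltac:(rewrite subn_gt0 //) ltac:(lia) nE.
pose E : R := (p.-1 * #|J| * (t - #|J|))%:R.
have nR (k : nat) : (0 < k)%N -> k%:R - 1 = (k.-1)%:R :> R.
  by case: k => // k _; rewrite -natr1 addrK.
have [||||| l lP lrho] := @pendant_graph_rho R p q n E.
- by [].
- lia.
- lia.
- have -> : p%:R - 2 = (p.-2)%:R :> R.
    by rewrite -[2]/(1 + 1) opprD addrA !nR //; lia.
  rewrite !nR; [|lia..].
  by rewrite -!natrM -natrD ltr_nat dE mE.
- by rewrite -!natrM -natrX ler_nat dE mE.
apply: le_lt_trans lrho; apply: rho_le; first exact: sqrtr_ge0.
move=> a f /(eigenfun_iso iso) [f' fK].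
have [a0|a0] := leP a 0; first exact: le_trans a0 (sqrtr_ge0 _).
have bip u v : adj (del_edges (Kst p t) D) u v -> isl u != isl v.
  by rewrite adj_del_edges adj_Kst => /andP[].
have quart := eigenfun_star_deletion (K := del_edges (Kst p t) D) erefl bip KA fK (lt0r_neq0 a0).
(* Now a is the square root of a^2, and a^2 is a root of the quadratic, hence at most l. *)
rewrite -[a]ger0_norm ?(ltW a0) // -sqrtr_sqr ler_wsqrtr // lP //.
rewrite -exprM -natrM -[RHS]quart; congr (_ - _%:R * _ + _).
by rewrite mE -mulnBr tE addnK.
Qed.

Local Close Scope ring_scope.

Theorem theorem2p6 (R : realType) (p q k e : nat)
  (hk : 0 < k) (hp : 2 < p) (hq : k * p + 2 < q) (he : e = p * (q - k)) :
  (exists G : graph ('I_p + 'I_q)%type, extremal R e G) /\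
  (forall G : graph ('I_p + 'I_q)%type, extremal R e G ->
     ~ exists s t : nat,
         [/\ 0 < s, s <= t & is_eKst G e s t \/ is_Kest G e s t]).
Proof.
have nq : (q - k < q)%N by lia.
have n1 : (1 < q - k)%N by nia.
have Hfam : Defs.family e (pendant_graph p q (q - k)).
  by rewrite he; apply: pendant_graph_family.
split; first exact: extremal_exists Hfam.
move=> G [[sub _ noiso _] Gmax] [s [t [s0 st eK]]].
have other m (i : 'I_m) : (1 < m)%N -> exists i', i' != i.
  move=> m1; have /card_gt0P [i' i'P] : (0 < #|predC1 i|)%N.
    by rewrite cardC1 card_ord; lia.
  by exists i'.
(* If s < p, then st <= (p-1)q < e because q > kp; in the swapped position st <= p^2 < e because q -
   k > p. *)
have bounds : ((s <= p) && (t <= q) || (s <= q) && (t <= p))%N ->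
    (e < s * t)%N -> s = p /\ (t <= q)%N.
  rewrite he => /orP[] /andP[h1 h2] est; last by nia.
  split=> //; apply/eqP; rewrite eqn_leq h1 leqNgt; apply/negP => sp.
  nia.
case: eK => [[/andP[lo hi] [i0 sd]]|[/andP[lo hi] [j0 sd]]].
  (* Deleting an edge of a star isolates a leaf. With s > 1 there is a second vertex on the side of
     [i0], as the order comparison needs. *)
  have s1 : (1 < s)%N.
    rewrite ltn_neqAle s0 andbT; apply/eqP => s1; subst s.
    have [D [DK cD Dv iso]] := sd.
    have [J cJ KA] := star_deletion_adj DK Dv.
    have /card_gt0P [j jJ] : (0 < #|J|)%N by rewrite cJ cD subn_gt0.
    have [|[i|j'] ji] := @no_isolated_iso _ _ _ _ (inr j) iso noiso.
    - by rewrite inE.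
    - by move: ji; rewrite adjC KA jJ !ord1 eqxx.
    - by move: ji; rewrite adj_del_edges adj_Kst andbF.
  have [i' i'P] := other _ i0 s1.
  have [|sp tq] := bounds (star_deletion_order (u0 := inl i') sub noiso sd _ erefl) hi.
    by apply: contraNneq i'P => -[->].
  subst s; have nt : (q - k < t)%N by move: hi; rewrite he ltn_pmul2l.
  rewrite he in sd.
  have := rho_star_deletion_lt R hp _ _ sd.
  rewrite nt tq => /(_ isT) lt.
  have := Gmax _ Hfam; rewrite leNgt lt //.
  (* Since t <= q, at most k columns are added, and q > kp + 2 leaves the exceptional vertex degree
     at least 3. *)
  nia.
have t1 : (1 < t)%N by case: t st j0 sd lo hi {bounds} => [|[|t]] //; lia.
have [j' j'P] := other _ j0 t1.
have [|sp tq] := bounds (star_deletion_order (u0 := inr j') sub noiso sd _ erefl) hi.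
  by apply: contraNneq j'P => -[->].
(* With s = p, the edge number e lies strictly between the consecutive multiples p(t-1) and pt of p,
   yet p divides e. *)
subst s e; move: lo hi; rewrite -{2}[p]muln1 -mulnBr !ltn_pmul2l //; lia.
Qed.
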